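(* Let $K$ be a differential field of characteristic $0$ with field of constants $C$, and let $M$ be a Picard-Vessiot extension of $K$. Then the differential Galois group of $M/K$ is an algebraic group of matrices over the field of constants $C$. That is, if $M=K(u_1,\dots,u_n)$ with $(u_1,\dots,u_n)$ a fundamental system of solutions, the group of matrices $(c_{ij})\in GL_n(C)$ describing the differential automorphisms $\sigma$ of $M$ over $K$ through $\sigma u_i=\sum_j c_{ij}u_j$ is an algebraic subgroup of $GL_n(C)$.
   Context: A differential field is a field with one derivation $y\mapsto y'$; its constants are the elements of derivative zero. For elements $u_1,\dots,u_n$ of a differential extension of $K$, $K(u_1,\dots,u_n)$ denotes the differential subfield generated by $K$ and $u_1,\dots,u_n$. Elements $u_1,\dots,u_n$ that are solutions of a homogeneous linear differential equation of order $n$ over $K$ form a fundamental system of solutions if their wronskian $\det(u_i^{(j-1)})_{1\le i,j\le n}$ is nonzero. A differential extension $M\supseteq K$ is a Picard-Vessiot extension of $K$ if $M=K(u_1,\dots,u_n)$ for a fundamental system of solutions of some homogeneous linear differential equation over $K$ and $M$ has the same field of constants as $K$. The differential Galois group of $M/K$ is the group of all differential field automorphisms of $M$ fixing $K$ elementwise. A group $G$ of automorphisms of a finite-dimensional vector space $V$ over an infinite field is algebraic if there is a set $S$ of polynomial functions on $\mathrm{End}(V)$ such that $G$ consists of exactly those automorphisms $s$ of $V$ with $P(s)=0$ for all $P\in S$. *)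

(* Defs.v *)
From HB Require Import structures.
From mathcomp Require Import all_boot all_order all_algebra.
From mathcomp Require Import mpoly.

Set Implicit Arguments.
Unset Strict Implicit.
Unset Printing Implicit Defensive.

Import GRing.Theory.

Local Open Scope ring_scope.

HB.mixin Record Field_isDifferential K of GRing.Field K := {
  der : K -> K;
  derD : {morph der : x y / x + y};
  derM : forall x y, der (x * y) = der x * y + x * der y
}.

#[short(type="diffFieldType")]
HB.structure Definition DiffField :=
  { K of GRing.Field K & Field_isDifferential K }.

Section Constants.
Variable K : diffFieldType.

Lemma der0 : der (0 : K) = 0.
Proof. by apply: (addrI (der 0)); rewrite -derD !addr0. Qed.

Lemma derN (x : K) : der (- x) = - der x.
Proof. by apply: (addrI (der x)); rewrite -derD !subrr der0. Qed.

Lemma der1 : der (1 : K) = 0.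
Proof.
by apply: (addrI (der 1)); rewrite addr0 -[in RHS](mulr1 1) derM mulr1 mul1r.
Qed.

Definition is_const : pred K := fun x => der x == 0.

Fact is_const_divring_closed : divring_closed is_const.
Proof.
split=> [|x y|x y]; rewrite /in_mem /= /is_const.
- by rewrite der1.
- by move=> /eqP dx /eqP dy; rewrite derD derN dx dy subrr.
move=> /eqP dx /eqP dy; rewrite derM dx mul0r add0r.
have [->|y0] := eqVneq y 0; first by rewrite invr0 der0 mulr0.
suff -> : der y^-1 = 0 by rewrite mulr0.
apply: (mulfI y0); rewrite mulr0 -[LHS]add0r -[X in X + _](mul0r y^-1) -dy.
by rewrite -derM divff // der1.
Qed.

HB.instance Definition _ :=
  GRing.isDivringClosed.Build K is_const is_const_divring_closed.

Record const_field := Const { const_val : K; _ : const_val \in is_const }.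

HB.instance Definition _ := [isSub for const_val].
HB.instance Definition _ := [Choice of const_field by <:].
HB.instance Definition _ := [SubChoice_isSubIntegralDomain of const_field by <:].
HB.instance Definition _ := [SubIntegralDomain_isSubField of const_field by <:].

End Constants.

Definition diff_ext (K M : diffFieldType) (iota : {rmorphism K -> M}) : Prop :=
  forall a : K, iota (der a) = der (iota a).

(* [S] is [Prop]-valued so that arbitrary subfields are covered, not only
   the decidable ones. *)
Definition diff_subfield (M : diffFieldType) (S : M -> Prop) : Prop :=
  [/\ S 1,
      forall x y, S x -> S y -> S (x - y),
      forall x y, S x -> S y -> S (x / y)
    & forall x, S x -> S (der x)].

Definition diff_generated (K M : diffFieldType) (iota : {rmorphism K -> M})
    (n : nat) (u : 'I_n -> M) (x : M) : Prop :=
  forall S : M -> Prop, diff_subfield S ->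
    (forall a : K, S (iota a)) -> (forall i, S (u i)) -> S x.

Definition solves_lde (K M : diffFieldType) (iota : {rmorphism K -> M})
    (n : nat) (a : 'I_n.+1 -> K) (y : M) : Prop :=
  \sum_(j < n.+1) iota (a j) * iter j der y = 0.

Definition wronskian (M : diffFieldType) (n : nat) (u : 'I_n -> M) : M :=
  \det (\matrix_(i < n, j < n) iter j der (u i)).

Definition fundamental_system (K M : diffFieldType)
    (iota : {rmorphism K -> M}) (n : nat) (u : 'I_n -> M) : Prop :=
  (exists a : 'I_n.+1 -> K,
     a ord_max != 0 /\ forall i, solves_lde iota a (u i))
  /\ wronskian u != 0.

Definition same_constants (K M : diffFieldType)
    (iota : {rmorphism K -> M}) : Prop :=
  forall x : M, der x = 0 <-> exists c : const_field K, iota (val c) = x.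

Definition picard_vessiot (K M : diffFieldType)
    (iota : {rmorphism K -> M}) : Prop :=
  [/\ diff_ext iota,
      exists (n : nat) (u : 'I_n -> M),
        fundamental_system iota u /\ forall x, diff_generated iota u x
    & same_constants iota].

Definition diff_gal (K M : diffFieldType) (iota : {rmorphism K -> M})
    (sigma : {rmorphism M -> M}) : Prop :=
  [/\ bijective sigma,
      forall x, sigma (der x) = der (sigma x)
    & forall a, sigma (iota a) = iota a].

Definition described_by (K M : diffFieldType) (iota : {rmorphism K -> M})
    (n : nat) (u : 'I_n -> M) (sigma : M -> M) (c : 'M[const_field K]_n)
    : Prop :=
  forall i, sigma (u i) = \sum_(j < n) iota (val (c i j)) * u j.

Definition gal_matrices (K M : diffFieldType) (iota : {rmorphism K -> M})
    (n : nat) (u : 'I_n -> M) (c : 'M[const_field K]_n) : Prop :=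
  c \in unitmx /\
  exists sigma : {rmorphism M -> M},
    diff_gal iota sigma /\ described_by iota u sigma c.

Definition matrix_group (F : fieldType) (n : nat) (G : 'M[F]_n -> Prop)
    : Prop :=
  [/\ forall A, G A -> A \in unitmx,
      G 1%:M,
      forall A B, G A -> G B -> G (A *m B)
    & forall A, G A -> G (invmx A)].

(* A polynomial function on n x n matrices is a polynomial in the n * n
   entries, indexed through [mxvec]. *)
Definition algebraic_group (F : fieldType) (n : nat) (G : 'M[F]_n -> Prop)
    : Prop :=
  matrix_group G /\
  exists S : {mpoly F[n * n]} -> Prop,
    forall A, G A <->
      A \in unitmx /\ forall P, S P -> P.@[mxvec A 0] = 0.

(* Main.v *)
Require Import Defs.
From HB Require Import structures.
From mathcomp Require Import all_boot all_order all_algebra.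
From mathcomp Require Import mpoly.
From mathcomp Require Import ring.
From Stdlib Require Import Classical.

Set Implicit Arguments.
Unset Strict Implicit.
Unset Printing Implicit Defensive.

Import GRing.Theory.

Local Open Scope ring_scope.

(** Let W be the wronskian matrix (u_i^(j)), which satisfies W' = W B with B
    over K.  An automorphism given by c sends W to cW, so M is generated as a
    field over K by the entries of W, and c comes from an automorphism iff
    p(W) = 0 is equivalent to p(cW) = 0 for all polynomials p over K in n * n
    variables: then p(W) / q(W) |-> p(cW) / q(cW) is well defined.  The
    implication p(W) = 0 -> p(cW) = 0 suffices: the ideal of relations of W
    meets each space of polynomials of bounded degree in a finite-dimensional
    subspace, and the injective substitution X |-> cX maps it onto itself as
    soon as it maps it into itself.  Finally, p(cW) is a polynomial in c with
    coefficients in M; expanding these over a C-linearly independent family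
    turns p(cW) = 0 into polynomial equations over C. *)

(** * Linear algebra and degree bounds in polynomial rings *)

(** Injectivity cancels powers of f until the relation has a nonzero constant coefficient; it then
    writes x as a combination of f x, f (f x), ..., which all satisfy P. This replaces the dimension
    count for a stable subspace. *)
Lemma stable_preimage_of_relation (F : fieldType) (V : lmodType F)
    (f : {linear V -> V}) (P : V -> Prop) (x : V) (s : seq F) :
    injective f -> P 0 -> (forall a y z, P y -> P z -> P (a *: y + z)) ->
    (forall y, P y -> P (f y)) -> P (f x) ->
    has (fun a => a != 0) s ->
    \sum_(i < size s) s`_i *: iter i f x = 0 -> P x.
Proof.
move=> inj_f P0 PL Pf Pfx; elim: s => [|a s IH] //= nz.
rewrite big_ord_recl /=; under eq_bigr do rewrite /bump /= add0n.
have iterP i : P (iter i.+1 f x) by elim: i => [|i IHi] //=; apply: Pf.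
have [a0 | a0] := eqVneq a 0.
  rewrite a0 eqxx /= in nz *.
  rewrite scale0r add0r => e; apply: IH => //; apply: inj_f.
  by rewrite linear0 linear_sum -[RHS]e; apply: eq_bigr => i _; rewrite linearZ.
move=> e; suff Q : P (\sum_(i < size s) s`_i *: iter i.+1 f x).
  have := PL (- a^-1) _ _ Q P0.
  rewrite addr0; suff -> : - a^-1 *: \sum_(i < size s) s`_i *: iter i.+1 f x = x by [].
  apply: (scalerI a0); rewrite scalerA mulrN divff // scaleN1r.
  by apply/eqP; rewrite eq_sym -addr_eq0; apply/eqP.
apply: (big_ind P) => // [y z Py Pz|i _].
  by rewrite -[y]scale1r; apply: PL.
by rewrite -[_ *: _]addr0; apply: PL.
Qed.

(** Only the k monomials of degree below d can occur, so the coefficient matrix of k + 1 of the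
    polynomials has more rows than columns and a nonzero left kernel. *)
Lemma msize_bounded_dependent (F : fieldType) (N d : nat)
    (p : nat -> {mpoly F[N]}) :
  (forall i, (msize (p i) <= d)%N) ->
  exists2 s : seq F, has (fun a => a != 0) s
    & \sum_(i < size s) s`_i *: p i = 0.
Proof.
move=> szp; pose k := #|{: 'X_{1..N < d} }|.
pose A := \matrix_(i < k.+1, j < k) (p i)@_(enum_val j).
have : kermx A != 0.
  by rewrite -mxrank_eq0 mxrank_ker subn_eq0 -ltnNge ltnS rank_leq_col.
case/rowV0Pn => v /sub_kermxP vA v0.
exists [seq v 0 i | i <- enum 'I_k.+1].
  have /existsP[i vi] : [exists i, v 0 i != 0].
    apply: contraR v0; rewrite negb_exists => /forallP h.
    by apply/eqP/rowP => i; rewrite mxE; apply/eqP; have := h i; rewrite negbK.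
  by apply/hasP; exists (v 0 i) => //; apply: map_f; rewrite mem_enum.
rewrite size_map size_enum_ord; apply/mpolyP => m; rewrite raddf_sum mcoeff0.
have [md|md] := ltnP (mdeg m) d; last first.
  rewrite big1 // => i _; rewrite /= mcoeffZ (memN_msupp_eq0 (msize_mdeg_ge _)) ?mulr0 //.
  exact: leq_trans md.
have /rowP/(_ (enum_rank (BMultinom md))) := vA; rewrite !mxE => e; rewrite -[RHS]e.
apply: eq_bigr => i _; rewrite /= mcoeffZ mxE enum_rankK /=; congr (_ * _).
by rewrite (nth_map i) ?size_enum_ord // nth_ord_enum.
Qed.

(** Since [msize] is the degree plus one for nonzero polynomials, the bound 2 says that the
    substituted polynomials have degree at most one, and degrees add in products over a domain. *)
Lemma mmap1_msize_le (R : idomainType) (N k : nat) (h : 'I_N -> {mpoly R[k]})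
    (m : 'X_{1..N}) :
  (forall i, (msize (h i) <= 2)%N) -> (msize (mmap1 h m) <= (mdeg m).+1)%N.
Proof.
move=> sz.
have mulle (a b : nat) (p q : {mpoly R[k]}) : (msize p <= a.+1)%N ->
    (msize q <= b.+1)%N -> (msize (p * q) <= (a + b).+1)%N.
  have [->|p0] := eqVneq p 0; first by rewrite mul0r msize0.
  have [->|q0] := eqVneq q 0; first by rewrite mulr0 msize0.
  rewrite msizeM // => pa qb; apply: (@leq_trans (a.+1 + b.+1).-1).
    by rewrite -!subn1 leq_sub2r // leq_add.
  by rewrite addSn addnS.
rewrite mdegE /mmap1.
elim/big_rec2: _ => [|i e p _]; first by rewrite msize1.
move=> le_e; apply: (mulle) => //; elim: (m i) => [|a IHa]; first by rewrite expr0 msize1.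
by rewrite exprS; apply: (mulle 1%N a).
Qed.

Lemma msize_comp_le (R : idomainType) (N k : nat) (h : 'I_N -> {mpoly R[k]})
    (p : {mpoly R[N]}) :
  (forall i, (msize (h i) <= 2)%N) ->
  (msize (mmap (@mpolyC k R) h p) <= msize p)%N.
Proof.
move=> sz; rewrite /mmap big_seq; apply: leq_trans (msize_sum _ _ _) _.
apply/bigmax_leqP_seq => m _ mp; rewrite mul_mpolyC.
apply: leq_trans (msizeZ_le _ _) _.
exact: leq_trans (mmap1_msize_le _ sz) (msize_mdeg_lt mp).
Qed.

(** * Evaluation of polynomials and descent of equations to a subfield *)

Lemma mmap_comp (R S T : comNzRingType) (f : {rmorphism R -> S})
    (g : {rmorphism S -> T}) N (h : 'I_N -> S) (p : {mpoly R[N]}) :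
  g (mmap f h p) = mmap (g \o f) (g \o h) p.
Proof.
rewrite /mmap rmorph_sum; apply: eq_bigr => m _ /=; rewrite rmorphM; congr (_ * _).
by rewrite /mmap1 rmorph_prod; apply: eq_bigr => i _; rewrite rmorphXn.
Qed.

Lemma mmap_ext (R S : nzRingType) (f f' : R -> S) N (h h' : 'I_N -> S)
    (p : {mpoly R[N]}) :
  f =1 f' -> h =1 h' -> mmap f h p = mmap f' h' p.
Proof.
move=> ef eh; rewrite /mmap; apply: eq_bigr => m _; rewrite ef.
by rewrite (mmap1_eq _ eh).
Qed.

(** If the coefficients of Q are linearly independent over F, Q vanishes at a point of F only if all
    its monomials do. Otherwise a linear relation eliminates one coefficient, and induction
    applies. *)
Lemma scalar_zero_locus (F L : fieldType) (j : {rmorphism F -> L}) (N : nat)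
    (Q : {mpoly L[N]}) :
  exists S : {mpoly F[N]} -> Prop, forall v : 'I_N -> F,
    Q.@[j \o v] = 0 <-> forall P, S P -> P.@[v] = 0.
Proof.
(* Monomials are generalised to arbitrary polynomials [P i], because eliminating [m i0] changes the
   other [P i] by multiples of [P i0]. *)
have key k (m : 'I_k -> L) (P : 'I_k -> {mpoly F[N]}) :
    exists S : {mpoly F[N]} -> Prop, forall v : 'I_N -> F,
      \sum_i m i * j (P i).@[v] = 0 <-> forall P, S P -> P.@[v] = 0.
  elim: k m P => [|k IH] m P.
    by exists (fun _ => False) => v; rewrite big_ord0; split.
  have [[a [i0 ai0] rel]|indep] := classic (exists2 a : 'I_k.+1 -> F,
      exists i, a i != 0 & \sum_i m i * j (a i) = 0); last first.
    exists (fun p => exists i, p = P i) => v; split=> [e _ [i ->]|h].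
      apply/eqP/negPn/negP => Pi; apply: indep.
      by exists (fun i => (P i).@[v]) => //; exists i.
    by apply: big1 => i _; rewrite h ?rmorph0 ?mulr0 //; exists i.
  have [S hS] := IH (fun i => m (lift i0 i))
    (fun i => P (lift i0 i) - (a (lift i0 i) / a i0) *: P i0).
  exists S => v; rewrite -hS.
  suff -> : \sum_i m i * j (P i).@[v] = \sum_i m (lift i0 i) *
      j (P (lift i0 i) - (a (lift i0 i) / a i0) *: P i0).@[v] by [].
  have mi0 : m i0 = - \sum_i m (lift i0 i) * j (a (lift i0 i) / a i0).
    have ja0 : j (a i0) != 0 by rewrite fmorph_eq0.
    apply: (mulIf ja0).
    rewrite mulNr mulr_suml; apply/eqP; rewrite -addr_eq0; apply/eqP.
    rewrite -[RHS]rel (bigD1_ord i0) //=; congr (_ + _).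
    by apply: eq_bigr => i _; rewrite -mulrA -rmorphM divfK.
  rewrite (bigD1_ord i0) //= mi0 mulNr mulr_suml addrC -sumrB.
  apply: eq_bigr => i _.
  by rewrite mevalB mevalZ rmorphB [j (_ * _.@[v])]rmorphM mulrBr mulrA.
pose X i := nth 0%MM (msupp Q) i.
have [S hS] := key (size (msupp Q)) (fun i => Q@_(X i))
  (fun i => 'X_[F, X i]).
exists S => v; rewrite -hS mevalE (big_nth 0%MM) big_mkord.
rewrite (eq_bigr (fun i : 'I_(size (msupp Q)) => Q@_(X i) * j 'X_[F, X i].@[v])) //.
move=> i _; rewrite mevalX rmorph_prod; congr (_ * _).
by apply: eq_bigr => k _; rewrite rmorphXn.
Qed.

(** * Polynomials in the entries of a matrix and the substitution X |-> cX *)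

Local Notation mxeval f A := (mmap f (fun k => mxvec A 0 k)).

Lemma rmorph_mxeval (R S T : comNzRingType) (f : {rmorphism R -> S})
    (g : {rmorphism S -> T}) n (A : 'M[S]_n) (p : {mpoly R[n * n]}) :
  g (mxeval f A p) = mxeval (g \o f) (map_mx g A) p.
Proof.
by rewrite mmap_comp; apply: mmap_ext => // k; rewrite -map_mxvec mxE.
Qed.

(** The substitution X |-> cX, with X the generic matrix [vec_mx (\row_k 'X_k)]. Through
    [comp_mpoly] it inherits linearity. *)
Definition mxsubst (R : comNzRingType) n (c : 'M[R]_n) :=
  comp_mpoly [tuple mxvec (map_mx (@mpolyC (n * n) R) c *m
                             vec_mx (\row_k 'X_k)) 0 k | k < n * n].

HB.instance Definition _ (R : comNzRingType) n (c : 'M[R]_n) :=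
  GRing.Linear.on (mxsubst c).

Lemma mxsubstE (R : comNzRingType) n (c : 'M[R]_n) p :
  mxsubst c p = mxeval (@mpolyC (n * n) R)
    (map_mx (@mpolyC (n * n) R) c *m vec_mx (\row_k 'X_k)) p.
Proof. by apply: mmap_ext => // k; rewrite tnth_mktuple. Qed.

Lemma mxeval_subst (R S : comNzRingType) (f : {rmorphism R -> S}) n
    (A : 'M[S]_n) (c : 'M[R]_n) (p : {mpoly R[n * n]}) :
  mxeval f A (mxsubst c p) = mxeval f (map_mx f c *m A) p.
Proof.
rewrite mxsubstE rmorph_mxeval; apply: mmap_ext => [a|k] /=; first exact: mmapC.
rewrite map_mxM -map_mx_comp; congr (mxvec (_ *m _) 0 k).
  by apply: eq_map_mx => a /=; rewrite mmapC.
apply: (can_inj mxvecK); apply/rowP => i.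
by rewrite -map_mxvec vec_mxK !mxE /= mmapX mmap1U.
Qed.

Lemma mxsubst_comp (R : comNzRingType) n (c d : 'M[R]_n) (p : {mpoly R[n * n]}) :
  mxsubst c (mxsubst d p) = mxsubst (d *m c) p.
Proof. by rewrite !(mxsubstE c) mxeval_subst mulmxA -map_mxM -mxsubstE. Qed.

Lemma mxsubst1 (R : comNzRingType) n (p : {mpoly R[n * n]}) :
  mxsubst 1%:M p = p.
Proof.
rewrite mxsubstE map_mx1 mul1mx -[RHS]comp_mpoly_id /comp_mpoly.
by apply: mmap_ext => // k; rewrite vec_mxK mxE tnth_mktuple.
Qed.

Lemma msize_mxsubst_le (R : idomainType) n (c : 'M[R]_n) (p : {mpoly R[n * n]}) :
  (msize (mxsubst c p) <= msize p)%N.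
Proof.
rewrite mxsubstE; apply: msize_comp_le => k.
case/mxvec_indexP: k => i l; rewrite mxvecE mxE.
apply: leq_trans (msize_sum _ _ _) _; apply/bigmax_leqP => s _.
by rewrite !mxE mul_mpolyC (leq_trans (msizeZ_le _ _)) // msizeX mdeg1.
Qed.

(** For invertible c the substitution X |-> cX is injective and does not raise degrees. The iterates
    of p are therefore linearly dependent, and [stable_preimage_of_relation] applies to the ideal of
    relations of A. *)
Lemma mxeval_eq0_unit (F L : fieldType) (f : {rmorphism F -> L}) n
    (A : 'M[L]_n) (c : 'M[F]_n) :
  c \in unitmx ->
  (forall p, mxeval f A p = 0 -> mxeval f (map_mx f c *m A) p = 0) ->
  forall p, mxeval f (map_mx f c *m A) p = 0 -> mxeval f A p = 0.
Proof.
move=> uc st p cAp.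
have szp i : (msize (iter i (mxsubst c) p) <= msize p)%N.
  by elim: i => //= i; apply: leq_trans; apply: msize_mxsubst_le.
have [s nz rel] := msize_bounded_dependent szp.
apply: (stable_preimage_of_relation (f := mxsubst c)
  (P := fun p => mxeval f A p = 0)) nz rel.
- apply: (can_inj (g := mxsubst (invmx c))) => q.
  by rewrite mxsubst_comp mulmxV // mxsubst1.
- exact: mmap0.
- by move=> a q r q0 r0; rewrite mmapD mmapZ q0 r0 mulr0 addr0.
- by move=> q q0; rewrite mxeval_subst; apply: st.
- by rewrite mxeval_subst.
Qed.

(** * Extension of a ring morphism to fractions *)

(** The map f p / f q |-> g p / g q is well defined: f and g have the same kernel, so a
    cross-multiplied equality for f also holds for g. *)
Lemma frac_rmorph_extend (R : comNzRingType) (L : fieldType)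
    (f g : {rmorphism R -> L}) :
  (forall p, f p = 0 <-> g p = 0) ->
  (forall x, exists p q, f q != 0 /\ x = f p / f q) ->
  exists s : {rmorphism L -> L}, forall p, s (f p) = g p.
Proof.
move=> fg0 frac.
have ex x : exists pq : R * R, (f pq.2 != 0) && (x == f pq.1 / f pq.2).
  by have [p [q [q0 ->]]] := frac x; exists (p, q); rewrite q0 eqxx.
(* The pair is an arbitrary choice; [sE] shows that the value does not depend on it. *)
pose s x := g (xchoose (ex x)).1 / g (xchoose (ex x)).2.
have g0 q : f q != 0 -> g q != 0.
  by apply: contra_neq => /fg0.
have sE p q : f q != 0 -> s (f p / f q) = g p / g q.
  rewrite /s => q0; case: (xchoose _) (xchooseP (ex (f p / f q))) => p' q' /=.
  case/andP=> q'0; rewrite eqr_div // -!rmorphM -subr_eq0 -rmorphB.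
  move/eqP/fg0/eqP; rewrite rmorphB subr_eq0 !rmorphM => /eqP e.
  by apply/eqP; rewrite eqr_div ?g0 // eq_sym e.
have s_zmod : zmod_morphism s.
  move=> x y; have [p [q [q0 ->]]] := frac x; have [r [t [t0 ->]]] := frac y.
  have -> : f p / f q - f r / f t = f (p * t - r * q) / f (q * t).
    rewrite !(rmorphB, rmorphM); field.
    by rewrite t0 q0.
  rewrite !sE ?rmorphM ?mulf_neq0 // !(rmorphB, rmorphM); field.
  by rewrite !g0.
have s_mon : monoid_morphism s.
  split=> [|x y].
    have -> : 1 = f 1 / f 1 :> L by rewrite rmorph1 divr1.
    by rewrite sE ?rmorph1 ?oner_eq0 // divr1.
  have [p [q [q0 ->]]] := frac x; have [r [t [t0 ->]]] := frac y.
  have -> : f p / f q * (f r / f t) = f (p * r) / f (q * t).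
    by rewrite !rmorphM mulf_div.
  by rewrite !sE ?rmorphM ?mulf_neq0 // mulf_div.
pose sM : {rmorphism L -> L} := HB.pack s
  (GRing.isZmodMorphism.Build L L s s_zmod)
  (GRing.isMonoidMorphism.Build L L s s_mon).
exists sM => p; have := sE p 1; rewrite !rmorph1 !divr1; apply.
exact: oner_neq0.
Qed.

(** * Derivations and wronskian matrices *)

Section DifferentialField.
Variable M : diffFieldType.
Implicit Types x y : M.

Lemma der_sum (I : Type) (r : seq I) (P : pred I) (F : I -> M) :
  der (\sum_(i <- r | P i) F i) = \sum_(i <- r | P i) der (F i).
Proof. exact: (big_morph _ (@derD M) (der0 M)). Qed.

Lemma der_div x y : y != 0 -> der (x / y) = (der x * y - x * der y) / y ^+ 2.
Proof.
move=> y0; have : der (x / y * y) = der x by rewrite divfK.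
rewrite derM => <-; field; exact: y0.
Qed.

Lemma der_mulmx m n p (A : 'M[M]_(m, n)) (B : 'M[M]_(n, p)) :
  map_mx der (A *m B) = map_mx der A *m B + A *m map_mx der B.
Proof.
apply/matrixP => i j; rewrite !mxE der_sum -big_split.
by apply: eq_bigr => k _; rewrite derM !mxE.
Qed.

(** Rows are indexed by the functions and columns by the order of derivation, so constant matrices
    act on the left and the differential equation on the right. *)
Definition wronskian_mx n (u : 'I_n -> M) : 'M[M]_n :=
  \matrix_(i < n, j < n) iter j der (u i).

End DifferentialField.

Section DifferentialExtension.
Variables (K M : diffFieldType) (iota : {rmorphism K -> M}).
Hypothesis ext : diff_ext iota.

Lemma der_iota_const (c : const_field K) : der (iota (val c)) = 0.
Proof. by rewrite -ext; case: c => x /= /eqP ->; rewrite rmorph0. Qed.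

Lemma der_iota_const_mx n (c : 'M[const_field K]_n) :
  map_mx der (map_mx iota (map_mx val c)) = 0.
Proof. by apply/matrixP => i j; rewrite !mxE der_iota_const. Qed.

Lemma iter_der_const_lin n (c : 'I_n -> const_field K) (u : 'I_n -> M) k :
  iter k der (\sum_j iota (val (c j)) * u j) =
  \sum_j iota (val (c j)) * iter k der (u j).
Proof.
elim: k => //= k ->; rewrite der_sum; apply: eq_bigr => j _.
by rewrite derM der_iota_const mul0r add0r.
Qed.

Lemma const_mx_descent n (X : 'M[M]_n) :
  same_constants iota -> map_mx der X = 0 ->
  exists c : 'M[const_field K]_n, X = map_mx iota (map_mx val c).
Proof.
move=> sc dX.
have ex (ij : 'I_n * 'I_n) : exists c : const_field K, iota (val c) = X ij.1 ij.2.
  by apply/sc; have /matrixP/(_ ij.1 ij.2) := dX; rewrite !mxE.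
have [c hc] := fin_all_exists ex.
by exists (\matrix_(i, j) c (i, j)); apply/matrixP => i j; rewrite !mxE hc.
Qed.

(** B is the companion matrix: it shifts the columns and, in the last one, expresses the n-th
    derivative by the lower ones. It depends on the equation alone and so serves u and its images
    under automorphisms alike. *)
Lemma wronskian_mx_der n (a : 'I_n.+1 -> K) :
  a ord_max != 0 ->
  exists B : 'M[K]_n, forall y : 'I_n -> M,
    (forall i, solves_lde iota a (y i)) ->
    map_mx der (wronskian_mx y) = wronskian_mx y *m map_mx iota B.
Proof.
move=> a0; exists (\matrix_(j, k) if (k.+1 < n)%N then (j == k.+1 :> nat)%:R
  else - (a (widen_ord (leqnSn n) j) / a ord_max)) => y sol.
apply/matrixP => i k; rewrite !mxE -iterS.
have [lt|ge] := ltnP k.+1 n.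
  rewrite (bigD1 (Ordinal lt)) //= !mxE /= lt eqxx rmorph1 mulr1.
  rewrite big1 ?addr0 // => j; rewrite -val_eqE /= !mxE lt => /negbTE ->.
  by rewrite rmorph0 mulr0.
have -> : k.+1 = n by apply/eqP; rewrite eqn_leq ge ltn_ord.
have ia0 : iota (a ord_max) != 0 by rewrite fmorph_eq0.
apply: (mulfI ia0); rewrite mulr_sumr.
have := sol i; rewrite /solves_lde big_ord_recr /= => /eqP.
rewrite addrC addr_eq0 => /eqP ->; rewrite -sumrN.
apply: eq_bigr => j _; rewrite !mxE ltnNge ge /= rmorphN fmorph_div.
by field; exact: ia0.
Qed.

(** The polynomials with this property contain the constants and, by A' = AB, the variables, and are
    closed under sums and products. One r' serves all such A, in particular both W and cW. *)
Lemma der_mxeval n (B : 'M[K]_n) (r : {mpoly K[n * n]}) :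
  exists r', forall A : 'M[M]_n,
    map_mx der A = A *m map_mx iota B ->
    der (mxeval iota A r) = mxeval iota A r'.
Proof.
pose good p := exists p', forall A : 'M[M]_n,
    map_mx der A = A *m map_mx iota B ->
    der (mxeval iota A p) = mxeval iota A p'.
have goodC c : good c%:MP.
  by exists (der c)%:MP => A _; rewrite !mmapC; exact: esym (ext c).
have goodD p q : good p -> good q -> good (p + q).
  move=> [p' hp] [q' hq]; exists (p' + q') => A dA.
  by rewrite !mmapD derD hp ?hq.
have goodM p q : good p -> good q -> good (p * q).
  move=> [p' hp] [q' hq]; exists (p' * q + p * q') => A dA.
  by rewrite rmorphD !rmorphM derM /= hp ?hq.
have goodX k : good 'X_k.
  case/mxvec_indexP: k => i k.
  exists (\sum_j B j k *: 'X_(mxvec_index i j)) => A dA.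
  rewrite mmapX mmap1U mxvecE raddf_sum /=.
  have /matrixP/(_ i k) := dA; rewrite !mxE => ->.
  by apply: eq_bigr => j _; rewrite mmapZ mmapX mmap1U mxvecE mxE mulrC.
elim/mpolyind: r => [|c m p _ _ IH]; first by rewrite -mpolyC0; apply: goodC.
apply: (goodD) => //; rewrite -mul_mpolyC; apply: (goodM) => //.
rewrite mpolyXE_id; apply: big_ind => // [|k _].
  by rewrite -mpolyC1; apply: goodC.
elim: (m k) => [|e IHe]; first by rewrite expr0 -mpolyC1; apply: goodC.
by rewrite exprS; apply: goodM.
Qed.

(** The fractions in the entries of W form a differential subfield, closed under derivation because
    W' = WB; it contains K and the u i, which are the first column of W. *)
Lemma diff_generated_frac n (u : 'I_n -> M) (B : 'M[K]_n) (x : M) :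
  map_mx der (wronskian_mx u) = wronskian_mx u *m map_mx iota B ->
  diff_generated iota u x ->
  exists p q, mxeval iota (wronskian_mx u) q != 0 /\
    x = mxeval iota (wronskian_mx u) p / mxeval iota (wronskian_mx u) q.
Proof.
set W := wronskian_mx u => dW; pose ev p := mxeval iota W p.
have evC c : ev c%:MP = iota c by rewrite /ev mmapC.
have ev1 : ev 1 = 1 by rewrite /ev rmorph1.
have evM p q : ev (p * q) = ev p * ev q by rewrite /ev rmorphM.
have evB p q : ev (p - q) = ev p - ev q by rewrite /ev rmorphB.
pose S x := exists p q, ev q != 0 /\ x = ev p / ev q.
have Sev p : S (ev p) by exists p, 1; rewrite ev1 divr1 oner_neq0.
move=> /(_ S); apply=> [|a|i]; last 2 first.
- by rewrite -evC.
- have n0 : (0 < n)%N by apply: leq_ltn_trans (ltn_ord i).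
  suff -> : u i = ev 'X_(mxvec_index i (Ordinal n0)) by [].
  by rewrite /ev mmapX mmap1U mxvecE mxE.
split.
- by rewrite -ev1.
- move=> _ _ [p [q [q0 ->]]] [r [t [t0 ->]]].
  exists (p * t - r * q), (q * t); rewrite !(evM, evB) mulf_neq0 //; split=> //.
  by field; rewrite t0 q0.
- move=> _ _ [p [q [q0 ->]]] [r [t [t0 ->]]].
  (* Division by zero yields 0 by convention, and this value must be a fraction too. *)
  have [r0|r0] := eqVneq (ev r) 0.
    by rewrite r0 mul0r invr0 mulr0 -(subrr 1) -ev1 -evB.
  exists (p * t), (q * r); rewrite !evM mulf_neq0 //; split=> //.
  by field; rewrite r0 t0 q0.
move=> _ [p [q [q0 ->]]].
have [p' hp] := der_mxeval B p; have [q' hq] := der_mxeval B q.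
exists (p' * q - p * q'), (q * q); rewrite !(evM, evB) mulf_neq0 //; split=> //.
by rewrite der_div // {1 2}/ev hp // hq.
Qed.

End DifferentialExtension.

(** * Galois matrices and the relations of the wronskian matrix *)

Section GaloisMatrices.
Variables (K M : diffFieldType) (iota : {rmorphism K -> M}).
Hypothesis ext : diff_ext iota.
Variables (n : nat) (u : 'I_n -> M) (B : 'M[K]_n).
Local Notation W := (wronskian_mx u).
Hypothesis derW : map_mx der W = W *m map_mx iota B.
Hypothesis genu : forall x, diff_generated iota u x.
Local Notation sc c := (map_mx iota (map_mx val c)).

(** Asking for one implication only makes this a family of polynomial conditions on c; for
    invertible c the converse comes from [mxeval_eq0_unit]. *)
Definition relation_stable (c : 'M[const_field K]_n) :=
  forall p : {mpoly K[n * n]},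
    mxeval iota W p = 0 -> mxeval iota (sc c *m W) p = 0.

Lemma der_sc_mulmx (c : 'M[const_field K]_n) :
  map_mx der (sc c *m W) = sc c *m W *m map_mx iota B.
Proof. by rewrite der_mulmx der_iota_const_mx // mul0mx add0r derW mulmxA. Qed.

(** [described_by] is the equality of the first columns; the other columns follow by
    differentiation, as c is constant and sigma commutes with the derivation. *)
Lemma described_byP (sigma : {rmorphism M -> M}) (c : 'M[const_field K]_n) :
  (forall x, sigma (der x) = der (sigma x)) ->
  described_by iota u sigma c <-> map_mx sigma W = sc c *m W.
Proof.
move=> sder; split=> [desc|/matrixP eW i].
  apply/matrixP => i k; rewrite !mxE.
  have -> : sigma (iter k der (u i)) = iter k der (sigma (u i)).
    by elim: {k}(val k) => //= k <-; rewrite sder.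
  rewrite desc iter_der_const_lin //.
  by apply: eq_bigr => j _; rewrite !mxE.
have n0 : (0 < n)%N by apply: leq_ltn_trans (ltn_ord i).
have := eW i (Ordinal n0); rewrite !mxE => ->.
by apply: eq_bigr => j _; rewrite !mxE.
Qed.

Lemma described_by_relation_stable (sigma : {rmorphism M -> M})
    (c : 'M[const_field K]_n) :
  diff_gal iota sigma -> described_by iota u sigma c -> relation_stable c.
Proof.
move=> [_ sder siota] /(described_byP _ sder) eW p /(congr1 sigma).
rewrite rmorph0 rmorph_mxeval eW => e; rewrite -[RHS]e.
by apply: mmap_ext => // a /=; rewrite siota.
Qed.

(** If p(W) = 0, then q(X) = p(c^-1 X) satisfies q(cW) = 0, hence q(W) = 0 by [mxeval_eq0_unit]. *)
Lemma relation_stable_invmx (c : 'M[const_field K]_n) :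
  c \in unitmx -> relation_stable c -> relation_stable (invmx c).
Proof.
move=> uc st p Wp; rewrite map_invmx -mxeval_subst.
apply: (mxeval_eq0_unit (c := map_mx val c)) => //; first by rewrite map_unitmx.
by rewrite mxeval_subst mulmxA -map_mxM mulVmx ?map_unitmx // map_mx1 mul1mx.
Qed.

(** As W and cW satisfy the same equation Y' = YB, the derivatives of p(W) and p(cW) are given by
    one polynomial p'. So sigma commutes with the derivation on polynomials in W, and then on
    fractions. *)
Lemma relation_stable_extend (c : 'M[const_field K]_n) :
  c \in unitmx -> relation_stable c ->
  exists sigma : {rmorphism M -> M},
    (forall p, sigma (mxeval iota W p) = mxeval iota (sc c *m W) p) /\
    forall x, sigma (der x) = der (sigma x).
Proof.
move=> uc st.
have frac x := diff_generated_frac ext derW (genu x).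
have [sigma hs] : exists s : {rmorphism M -> M}, forall p,
    s (mxeval iota W p) = mxeval iota (sc c *m W) p.
  apply: frac_rmorph_extend frac => p; split; first exact: st.
  by apply: mxeval_eq0_unit => //; rewrite map_unitmx.
exists sigma; split=> // x.
have sder_ev p : sigma (der (mxeval iota W p)) = der (sigma (mxeval iota W p)).
  have [p' hp] := der_mxeval ext B p.
  by rewrite hp // !hs hp // der_sc_mulmx.
have [p [q [q0 ->]]] := frac x.
rewrite der_div // !fmorph_div der_div ?fmorph_eq0 //.
by rewrite rmorphB !rmorphM !sder_ev.
Qed.

(** For fixed p, the polynomial p(XW) in X over M is evaluated at a matrix of constants, so
    [scalar_zero_locus] turns its vanishing into equations over the constants. *)
Lemma relation_stable_zero_locus :
  exists S : {mpoly (const_field K)[n * n]} -> Prop, forall c,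
    relation_stable c <-> forall P, S P -> P.@[mxvec c 0] = 0.
Proof.
pose val_iota : {rmorphism const_field K -> M} := iota \o val.
have locus p : exists S : {mpoly (const_field K)[n * n]} -> Prop, forall c,
    mxeval iota (sc c *m W) p = 0 <-> forall P, S P -> P.@[mxvec c 0] = 0.
  pose X : 'M[{mpoly M[n * n]}]_n := vec_mx (\row_k 'X_k).
  have [S hS] := scalar_zero_locus val_iota
    (mxeval (@mpolyC (n * n) M \o iota) (X *m map_mx (@mpolyC (n * n) M) W) p).
  exists S => c; rewrite -hS rmorph_mxeval.
  suff -> : mxeval iota (sc c *m W) p =
    mxeval (meval (val_iota \o mxvec c 0) \o (@mpolyC (n * n) M \o iota))
      (map_mx (meval (val_iota \o mxvec c 0))
         (X *m map_mx (@mpolyC (n * n) M) W)) p by [].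
  apply: mmap_ext => [a|k] /=; first by rewrite mevalC.
  rewrite map_mxM -!map_mx_comp; congr (mxvec (_ *m _) 0 k).
    apply: (can_inj mxvecK); rewrite -!map_mxvec vec_mxK.
    by apply/rowP => i; rewrite !mxE /= mevalXU.
  by apply/matrixP => i j; rewrite !mxE /= mevalC.
(* The union over all relations p of W; admitting every S that cuts out the locus of p avoids
   choosing one for each p. *)
exists (fun P => exists2 p, mxeval iota W p = 0 &
  exists2 S : {mpoly (const_field K)[n * n]} -> Prop,
    forall c, mxeval iota (sc c *m W) p = 0 <->
      forall P, S P -> P.@[mxvec c 0] = 0 & S P) => c.
split=> [st P [p Wp [S hS SP]]|h p Wp].
  by have [loc _] := hS c; apply: loc SP; apply: st.
by have [S hS] := locus p; apply/hS => P SP; apply: h; exists p => //; exists S.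
Qed.

Lemma gal_matricesP (c : 'M[const_field K]_n) :
  gal_matrices iota u c <-> c \in unitmx /\ relation_stable c.
Proof.
split=> [[uc [sigma [gal desc]]]|[uc st]].
  by split=> //; apply: described_by_relation_stable desc.
split=> //; have [sigma [sev sder]] := relation_stable_extend uc st.
(* The extension attached to c^-1 will be the inverse of sigma. *)
have [tau [tev _]] : exists tau : {rmorphism M -> M},
    (forall p, tau (mxeval iota W p) = mxeval iota (sc (invmx c) *m W) p) /\
    forall x, tau (der x) = der (tau x).
  by apply: relation_stable_extend; rewrite ?unitmx_inv //; apply: relation_stable_invmx.
have frac x := diff_generated_frac ext derW (genu x).
exists sigma; split; last first.
  apply/described_byP => //; apply/matrixP => i j; rewrite [LHS]mxE.
  have /= := sev 'X_(mxvec_index i j).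
  by rewrite !mmapX !mmap1U !mxvecE.
split=> // [|a]; last by have := sev a%:MP; rewrite !mmapC.
have scK d e : d *m e = 1%:M -> sc d *m (sc e *m W) = W.
  by move=> de; rewrite mulmxA -!map_mxM de !map_mx1 mul1mx.
exists tau => x; have [p [q [q0 ->]]] := frac x; rewrite !fmorph_div.
  by rewrite !sev -!mxeval_subst !tev !mxeval_subst !scK ?mulmxV.
by rewrite !tev -!mxeval_subst !sev !mxeval_subst !scK ?mulVmx.
Qed.

End GaloisMatrices.

(** * The matrix representation of the Galois group and its algebraicity *)

Theorem mainTheorem2 (K M : diffFieldType) (iota : {rmorphism K -> M})
    (charK : [pchar K] =i pred0) (pvM : picard_vessiot iota)
    (n : nat) (u : 'I_n -> M) (fsu : fundamental_system iota u)
    (genu : forall x : M, diff_generated iota u x) :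
  [/\ forall sigma : {rmorphism M -> M}, diff_gal iota sigma ->
        exists! c : 'M[const_field K]_n,
          c \in unitmx /\ described_by iota u sigma c,
      forall (sigma tau : {rmorphism M -> M}) (c : 'M[const_field K]_n),
        diff_gal iota sigma -> diff_gal iota tau ->
        described_by iota u sigma c -> described_by iota u tau c ->
        sigma =1 tau,
      forall (sigma tau : {rmorphism M -> M}) (c d : 'M[const_field K]_n),
        diff_gal iota sigma -> diff_gal iota tau ->
        described_by iota u sigma c -> described_by iota u tau d ->
        described_by iota u (sigma \o tau) (d *m c)
    & algebraic_group (gal_matrices iota u)].
Proof.
have [ext _ sc] := pvM; have [[a [a0 sol]] wu] := fsu.
have [B hB] := wronskian_mx_der iota a0; have derW := hB u sol.
have uW : wronskian_mx u \in unitmx by rewrite unitmxE unitfE.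
(* The entries of d come from K and are fixed by sigma, so sigma (tau W) = sigma (dW) = dcW; hence
   the reversed order. *)
have comp (sigma tau : {rmorphism M -> M}) (c d : 'M[const_field K]_n) :
    diff_gal iota sigma -> diff_gal iota tau ->
    described_by iota u sigma c -> described_by iota u tau d ->
    described_by iota u (sigma \o tau) (d *m c).
  move=> [_ ds si] [_ dt _] /(described_byP ext _ _ ds) hc.
  move=> /(described_byP ext _ _ dt) hd.
  apply/(@described_byP _ _ _ ext n u (sigma \o tau)) => [x|]; first by rewrite /= dt ds.
  rewrite map_mx_comp hd map_mxM hc mulmxA !map_mxM.
  congr (_ *m _ *m _); apply/matrixP => i j; rewrite !mxE; exact: si.
split=> //.
- move=> sigma [bij sder siota].
  pose y i := sigma (u i).
  have sW : map_mx sigma (wronskian_mx u) = wronskian_mx y.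
    apply/matrixP => i k; rewrite !mxE /y.
    by elim: {k}(val k) => //= k <-; rewrite sder.
  have soly i : solves_lde iota a (y i).
    have /(congr1 sigma) := sol i; rewrite rmorph0 rmorph_sum => e.
    rewrite /solves_lde -[RHS]e; apply: eq_bigr => j _; rewrite rmorphM siota.
    by congr (_ * _); elim: {j}(val j) => //= j ->; rewrite sder.
  have [X hX] : exists X, X *m wronskian_mx u = wronskian_mx y.
    by exists (wronskian_mx y *m invmx (wronskian_mx u)); rewrite mulmxKV.
  (* Both W and XW satisfy Y' = YB, so X'W = 0, and W is invertible. *)
  have dX : map_mx der X = 0.
    have : map_mx der (X *m wronskian_mx u) = X *m map_mx der (wronskian_mx u).
      by rewrite hX (hB y soly) derW mulmxA hX.
    rewrite der_mulmx => /eqP; rewrite -subr_eq0 addrK => /eqP e.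
    by rewrite -[LHS](mulmxK uW) e mul0mx.
  have [c hc] := const_mx_descent sc dX.
  exists c; split.
    split; last by apply/(described_byP ext) => //; rewrite sW -hX hc.
    rewrite -(map_unitmx (val : {rmorphism const_field K -> K})) -(map_unitmx iota) -hc.
    have : wronskian_mx y \in unitmx by rewrite -sW map_unitmx.
    by rewrite -hX unitmx_mul => /andP[].
  move=> d [_ /(described_byP ext _ _ sder)]; rewrite sW -hX => /(can_inj (mulmxK uW)).
  by rewrite hc => /map_mx_inj/map_mx_inj.
- move=> sigma tau c [_ ds si] [_ dt ti] hs ht x.
  (* The elements on which sigma and tau agree form a differential subfield containing K and the u
     i. *)
  apply: (genu x (fun x => sigma x = tau x)).
  + split=> [|y z ey ez|y z ey ez|y ey]; first by rewrite !rmorph1.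
    * by rewrite !rmorphB ey ez.
    * by rewrite !fmorph_div ey ez.
    * by rewrite ds dt ey.
  + by move=> b; rewrite si ti.
  + by move=> i; rewrite hs ht.
have galP := gal_matricesP ext derW genu.
split.
  split=> [A [] //||A C|A].
  - apply/galP; split; first exact: unitmx1.
    by move=> p; rewrite !map_mx1 mul1mx.
  - move=> [uA [s [gs hs]]] [uC [t [gt ht]]].
    split; first by rewrite unitmx_mul uA.
    (* By the order reversal in [comp], the product of the matrices of s and t belongs to t after
       s. *)
    exists (t \o s); split; last exact: comp.
    have [[bs ds is_] [bt dt it]] := (gs, gt).
    split=> [|x|b] /=; first exact: bij_comp.
      by rewrite ds dt.
    by rewrite is_ it.
  - move=> /galP[uA stA]; apply/galP; rewrite unitmx_inv; split=> //.
    exact: relation_stable_invmx.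
have [S hS] := relation_stable_zero_locus iota u.
by exists S => A; rewrite -hS; apply: galP.
Qed.
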